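(* Suppose that each $f_i$ is $L_i$-smooth and convex, and that $f=\frac1n\sum_{i=1}^nf_i$ is $\mu$-strongly convex. Consider the vectors $v^t$ generated within one outer iteration (started at $x^0$) of SARAH with sampling probabilities $p_i=\frac{L_i}{\sum_{j=1}^nL_j}$ and step size $0<\eta<2/\bar L$. Then, for any $t\ge1$, $$\mathrm{E}\|v^t\|^2\le\left[1-\left(\tfrac{2}{\eta\bar L}-1\right)\mu^2\eta^2\right]\mathrm{E}\|v^{t-1}\|^2\le\left[1-\left(\tfrac{2}{\eta\bar L}-1\right)\mu^2\eta^2\right]^t\mathrm{E}\|\nabla f(x^0)\|^2.$$
   Context: $f_i:\mathbb{R}^d\to\mathbb{R}$ are differentiable, $L_i$-smooth means $\|\nabla f_i(x)-\nabla f_i(y)\|\le L_i\|x-y\|$ for all $x,y$ (with $L_i>0$), and $\bar L=\frac1n\sum_{i=1}^nL_i$. SARAH with importance sampling, one outer iteration started at $x^0$: $v^0=\frac1n\sum_{i=1}^n\nabla f_i(x^0)$, $x^1=x^0-\eta v^0$; for $t=1,2,\dots$ (up to the inner loop length): sample $i_t\in[n]$ independently with $\mathrm{Prob}(i_t=i)=p_i$, set $v^t=\frac{1}{np_{i_t}}\left(\nabla f_{i_t}(x^t)-\nabla f_{i_t}(x^{t-1})\right)+v^{t-1}$ and $x^{t+1}=x^t-\eta v^t$. *)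

(* Defs.v *)
From HB Require Import structures.
From mathcomp Require Import all_boot all_order all_algebra finmap.
From mathcomp Require Import all_classical all_reals all_analysis.

Set Implicit Arguments.
Unset Strict Implicit.
Unset Printing Implicit Defensive.

Import Order.TTheory GRing.Theory Num.Theory.
Import numFieldNormedType.Exports.

Local Open Scope classical_set_scope.
Local Open Scope ring_scope.

(* The norm carried by 'rV[R]_d in the library is the sup norm; it is only used
   here for its topology, and the Euclidean norm is spelled out. *)
Definition enorm (R : realType) (d : nat) (v : 'rV[R]_d) : R :=
  Num.sqrt (\sum_(j < d) v ord0 j ^+ 2).

Definition gradient (R : realType) (d : nat) (f : 'rV[R]_d -> R)
    (x : 'rV[R]_d) : 'rV[R]_d :=
  \row_(j < d) 'D_(delta_mx ord0 j) f x.

Definition smooth (R : realType) (d : nat) (L : R) (f : 'rV[R]_d -> R) : Prop :=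
  forall x y : 'rV[R]_d,
    enorm (gradient f x - gradient f y) <= L * enorm (x - y).

Definition strongly_convex (R : realType) (d : nat) (mu : R)
    (f : 'rV[R]_d -> R) : Prop :=
  forall (x y : 'rV[R]_d) (t : R), 0 <= t -> t <= 1 ->
    f (t *: x + (1 - t) *: y) <=
      t * f x + (1 - t) * f y - mu / 2 * t * (1 - t) * enorm (x - y) ^+ 2.

Definition mean (R : realType) (n : nat) (a : 'I_n -> R) : R :=
  n%:R^-1 * \sum_(k < n) a k.

(* The product rule for every finite subfamily of the sigma-algebras F i, which
   are meant to consist of measurable sets. *)
Definition mutually_independent (disp : measure_display)
    (T : measurableType disp) (R : realType) (P : probability T R)
    (I : choiceType) (F : I -> set (set T)) : Prop :=
  forall (J : {fset I}) (A : I -> set T), (forall i, i \in J -> F i (A i)) ->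
    P (\bigcap_(i in [set` J]) A i) = (\prod_(i <- J) P (A i))%E.

(* Sigma-algebra generated by a random vector: the library puts no measurable
   structure on 'rV[R]_d, so it is generated by the coordinates (this is the
   sigma-algebra pulled back from the Borel sets of R^d). *)
Definition sigma_vector (T : Type) (R : realType) (d : nat)
    (X : T -> 'rV[R]_d) : set (set T) :=
  g_sigma_preimage (fun (j : 'I_d) (w : T) => X w ord0 j).

Definition sigma_index (T : Type) (n : nat) (i : T -> 'I_n) : set (set T) :=
  preimage_set_system setT i setT.

(* Member 0 of the family is the starting point; member t >= 1 is the index
   drawn at step t (i 0 is never used). *)
Definition sarah_sigmas (T : Type) (R : realType) (d n : nat)
    (X0 : T -> 'rV[R]_d) (i : nat -> T -> 'I_n) (t : nat) : set (set T) :=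
  if t is 0%N then sigma_vector X0 else sigma_index (i t).

(* The pair (x^t, v^t) of the inner loop started at x0, along the sequence
   i 1, i 2, ... of sampled indices. *)
Fixpoint sarah (R : realType) (d n : nat) (f : 'I_n -> 'rV[R]_d -> R)
    (p : 'I_n -> R) (eta : R) (x0 : 'rV[R]_d) (i : nat -> 'I_n) (t : nat) :
    'rV[R]_d * 'rV[R]_d :=
  match t with
  | 0%N => (x0, n%:R^-1 *: \sum_(k < n) gradient (f k) x0)
  | s.+1 =>
      let: (x, v) := sarah f p eta x0 i s in
      let x' := x - eta *: v in
      let k := i s.+1 in
      (x', (n%:R * p k)^-1 *: (gradient (f k) x' - gradient (f k) x) + v)
  end.

(* Main.v *)
Require Import Defs.
From HB Require Import structures.
From mathcomp Require Import all_boot all_order all_algebra finmap.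
From mathcomp Require Import all_classical all_reals all_analysis.
From mathcomp Require Import measurable_realfun ring lra.

Set Implicit Arguments.
Unset Strict Implicit.
Unset Printing Implicit Defensive.

Import Order.TTheory GRing.Theory Num.Theory.
Import numFieldNormedType.Exports.

Local Open Scope classical_set_scope.
Local Open Scope ring_scope.

(**
Let x' = x - eta v and let D_k be the increment of the gradient of f_k from x
to x'. One step replaces v by v + D_k / (n p_k) with probability p_k, and the
choice p_k = L_k / sum_j L_j makes the weight 1 / (n p_k) equal to Lbar / L_k.
Expanding the square, the mean of the new squared norm is

  |v|^2 + 2 <D, v> + (Lbar / n) sum_k |D_k|^2 / L_k,   D = (1/n) sum_k D_k.

Each f_k is convex and L_k-smooth, so its gradient is cocoercive ([cocoercive]):
|D_k|^2 / L_k <= <D_k, x' - x> = - eta <D_k, v>. Hence the mean is at most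
|v|^2 + (2 - eta Lbar) <D, v> ([transition_sqr_le]), and strong convexity bounds
<D, v> by - mu eta |v|^2; since mu <= Lbar whenever v <> 0, the stated rate
follows ([transition_contraction]).

This bound holds at every pair (x, v), not only at the pairs that the algorithm
reaches, so no conditional expectation is needed. The operator [transition],
which averages a function over one step, is linear and monotone, so its iterates
on |v|^2 decrease geometrically at every starting pair ([iter_transition_le]).
It remains to see that E |v^t|^2 is the expected value of the t-th iterate at
the initial pair ([expectation_state]). The indices take finitely many values,
so the expectation splits along the events {i_s = h_s for all s in J}, and on
each of them the integrand is a continuous function of X0; such a function is
measurable for the sigma-algebra of X0, which is independent of the event
([decoupling]).

The expectations may be infinite and the rate is not visibly nonnegative, so the
inequalities are proved for the integrands before integrating; a negative rate
forces the integrands to vanish ([integral_chain_le]).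
*)

(** * The Euclidean inner product *)

Definition dot (R : realType) (d : nat) (u v : 'rV[R]_d) : R :=
  \sum_(j < d) u ord0 j * v ord0 j.

Lemma dotC (R : realType) d (u v : 'rV[R]_d) : dot u v = dot v u.
Proof. by apply: eq_bigr => j _; rewrite mulrC. Qed.

Lemma dotDl (R : realType) d (u v w : 'rV[R]_d) :
  dot (u + v) w = dot u w + dot v w.
Proof. by rewrite -big_split; apply: eq_bigr => j _; rewrite mxE mulrDl. Qed.

Lemma dotZl (R : realType) d (a : R) (u w : 'rV[R]_d) :
  dot (a *: u) w = a * dot u w.
Proof. by rewrite mulr_sumr; apply: eq_bigr => j _; rewrite mxE mulrA. Qed.

Lemma dotNl (R : realType) d (u w : 'rV[R]_d) : dot (- u) w = - dot u w.
Proof. by rewrite -scaleN1r dotZl mulN1r. Qed.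

Lemma dotBl (R : realType) d (u v w : 'rV[R]_d) :
  dot (u - v) w = dot u w - dot v w.
Proof. by rewrite dotDl dotNl. Qed.

Lemma dotDr (R : realType) d (w u v : 'rV[R]_d) :
  dot w (u + v) = dot w u + dot w v.
Proof. by rewrite !(dotC w) dotDl. Qed.

Lemma dotZr (R : realType) d (a : R) (w u : 'rV[R]_d) :
  dot w (a *: u) = a * dot w u.
Proof. by rewrite !(dotC w) dotZl. Qed.

Lemma dotNr (R : realType) d (w u : 'rV[R]_d) : dot w (- u) = - dot w u.
Proof. by rewrite !(dotC w) dotNl. Qed.

Lemma dotBr (R : realType) d (w u v : 'rV[R]_d) :
  dot w (u - v) = dot w u - dot w v.
Proof. by rewrite dotDr dotNr. Qed.

Lemma dot_sumr (R : realType) d n (w : 'rV[R]_d) (u : 'I_n -> 'rV[R]_d) :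
  dot w (\sum_k u k) = \sum_k dot w (u k).
Proof.
rewrite exchange_big; apply: eq_bigr => j _.
by rewrite summxE mulr_sumr.
Qed.

Lemma dotvv_ge0 (R : realType) d (u : 'rV[R]_d) : 0 <= dot u u.
Proof. by apply: sumr_ge0 => j _; rewrite -expr2 sqr_ge0. Qed.

Lemma enorm_ge0 (R : realType) d (u : 'rV[R]_d) : 0 <= enorm u.
Proof. exact: sqrtr_ge0. Qed.

Lemma enorm_sqr (R : realType) d (u : 'rV[R]_d) : enorm u ^+ 2 = dot u u.
Proof.
rewrite sqr_sqrtr; last by apply: sumr_ge0 => j _; exact: sqr_ge0.
by apply: eq_bigr => j _; rewrite expr2.
Qed.

(** * Gradients *)

Section gradient_theory.
Context (R : realType) (d : nat).
Implicit Types (f : 'rV[R]_d -> R) (x y h : 'rV[R]_d).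

Lemma derive_gradient f x h :
  differentiable f x -> 'D_h f x = dot (gradient f x) h.
Proof.
move=> df; rewrite deriveE// {1}[h]row_sum_delta linear_sum.
by apply: eq_bigr => j _; rewrite linearZ mxE deriveE// mulrC.
Qed.

Lemma is_derive_along_line f x h (t : R) :
  differentiable f (t *: h + x) ->
  is_derive t 1 (fun s => f (s *: h + x)) (dot (gradient f (t *: h + x)) h).
Proof.
move=> df; rewrite -derive_gradient//.
have dfh := diff_derivable (v := h) df.
have E : (fun s : R => s^-1 *: (((fun r : R => f (r *: h + x)) \o shift t)
     (s *: (1 : R)) - f (t *: h + x))) =
   (fun s : R => s^-1 *: ((f \o shift (t *: h + x)) (s *: h) - f (t *: h + x))).
  apply/funext => s /=; congr (_ *: (f _ - _)).
  by rewrite [s *: 1]mulr1 scalerDl addrA.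
by split; rewrite /derivable /derive E.
Qed.

Lemma gradient_mean n (f : 'I_n -> 'rV[R]_d -> R) x :
  (forall k, differentiable (f k) x) ->
  gradient (fun z => mean (fun k => f k z)) x =
  n%:R^-1 *: \sum_(k < n) gradient (f k) x.
Proof.
move=> df; apply/rowP => j; rewrite !mxE summxE.
have dfj k : derivable (f k) x (delta_mx ord0 j) by exact: diff_derivable.
rewrite (_ : (fun z => _) = n%:R^-1 *: \sum_(k < n) f k); last first.
  by apply/funext => z; rewrite /mean fctE fct_sumE.
rewrite deriveZ; last exact: derivable_sum.
rewrite derive_sum//; congr (_ * _).
by apply: eq_bigr => k _; rewrite mxE.
Qed.

Lemma differentiable_mean n (f : 'I_n -> 'rV[R]_d -> R) x :
  (forall k, differentiable (f k) x) ->
  differentiable (fun z => mean (fun k => f k z)) x.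
Proof.
move=> df.
rewrite (_ : (fun z => _) = n%:R^-1 *: \sum_(k < n) f k); last first.
  by apply/funext => z; rewrite /mean fctE fct_sumE.
by apply: differentiableZ; apply: differentiable_sum.
Qed.

End gradient_theory.

(** * First-order inequalities for smooth and strongly convex functions *)

Section first_order.
Context (R : realType) (d : nat).
Implicit Types (f : 'rV[R]_d -> R) (x y h : 'rV[R]_d) (L mu : R).

Lemma strongly_convex0 f :
  convex_function [set: convex_lmodType 'rV[R]_d] f -> strongly_convex 0 f.
Proof.
move=> cf x y t t0 t1; rewrite mul0r !mul0r subr0.
have := cf (Itv01 t0 t1) x y; rewrite !inE => /(_ I I).
by rewrite convRE.
Qed.

(** The chord inequality at parameter s, divided by s, is a bound on the
    difference quotient in the direction y - x. With mu = 0 this is the tangent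
    inequality of convex functions. *)
Lemma strongly_convex_gradient mu f x y : differentiable f x ->
  strongly_convex mu f ->
  f x + dot (gradient f x) (y - x) + mu / 2 * dot (y - x) (y - x) <= f y.
Proof.
move=> df cf.
have /cvg_ex[/= l fl] := diff_derivable (v := y - x) df.
have El : l = dot (gradient f x) (y - x).
  by rewrite -derive_gradient//; apply/esym/cvg_lim.
rewrite El in fl.
suff : dot (gradient f x) (y - x) <= f y - f x - mu / 2 * dot (y - x) (y - x).
  by lra.
have fr : (fun s : R => s^-1 *: ((f \o shift x) (s *: (y - x)) - f x)) @ 0^'+
   --> dot (gradient f x) (y - x).
  exact: (cvg_dnbhs_at_right fl).
have gr : (fun s : R => f y - f x - mu / 2 * (1 - s) * dot (y - x) (y - x))
   @ 0^'+ --> f y - f x - mu / 2 * dot (y - x) (y - x).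
  apply: cvg_at_right_filter.
  rewrite (_ : mu / 2 * dot _ _ = mu / 2 * (1 - 0) * dot (y - x) (y - x));
    last by rewrite subr0 mulr1.
  apply: cvgB; first exact: cvg_cst.
  apply: cvgMr_tmp; apply: cvgMl_tmp; apply: cvgB; first exact: cvg_cst.
  exact: cvg_id.
apply: (ler_cvg_to fr gr).
near=> s.
have s0 : 0 < s by near: s; exact: nbhs_right_gt.
have s1 : s <= 1 by near: s; exact: nbhs_right_le.
have := cf y x s (ltW s0) s1.
rewrite (_ : s *: y + (1 - s) *: x = s *: (y - x) + x); last first.
  by rewrite scalerBr scalerBl scale1r -addrA (addrC (- _) x) addrA.
rewrite enorm_sqr /= /GRing.scale/= => H.
rewrite ler_pdivrMl//; lra.
Unshelve. all: by end_near. Qed.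


(** The increment of the gradient is only paired with the displacement itself,
    so completing the square replaces the Cauchy-Schwarz inequality. *)
Lemma smooth_dot L f x y : 0 < L -> smooth L f ->
  dot (gradient f x - gradient f y) (x - y) <= L * dot (x - y) (x - y).
Proof.
move=> L0 sf; set D := gradient f x - gradient f y; set h := x - y.
have D2 : dot D D <= L ^+ 2 * dot h h.
  rewrite -!enorm_sqr -exprMn lerXn2r ?nnegrE ?mulr_ge0 ?enorm_ge0 ?(ltW L0)//.
  exact: sf.
clearbody D h; have := dotvv_ge0 (D - L *: h).
rewrite !(dotBl, dotBr, dotZl, dotZr) (dotC h D) => H.
rewrite -(ler_pM2l L0); lra.
Qed.

(** The difference of the two sides along the segment from x to y is monotone by
    [smooth_dot]; integrating that bound instead of applying it once is what
    yields the factor 1/2. *)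
Lemma smooth_upper_bound L f x y : 0 < L -> smooth L f ->
  (forall z, differentiable f z) ->
  f y <= f x + dot (gradient f x) (y - x) + L / 2 * dot (y - x) (y - x).
Proof.
move=> L0 sf df; set h := y - x.
pose phi (t : R) := f (t *: h + x) - t * dot (gradient f x) h
  - L / 2 * dot h h * t ^+ 2.
have dphi (t : R) : is_derive t 1 phi (dot (gradient f (t *: h + x)) h
    - dot (gradient f x) h - L * dot h h * t).
  have H1 := is_derive_along_line (h := h) (df (t *: h + x)).
  have H2 : is_derive t 1 (fun s : R => s * dot (gradient f x) h)
      (dot (gradient f x) h).
    by apply: is_derive_eq; rewrite [t *: 0]mulr0 add0r [_%:A]mulr1.
  have H3 : is_derive t 1 (fun s : R => L / 2 * dot h h * s ^+ 2)
      (L * dot h h * t).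
    by apply: is_derive_eq; rewrite /GRing.scale/=; field.
  exact: is_deriveB.
have : phi 1 <= phi 0.
  apply: (@ler0_derive1_le_cc _ phi 0 1); rewrite ?in_itv/= ?lexx ?ler01//.
  - move=> t; rewrite in_itv/= => /andP[t0 _]; rewrite derive1E derive_val.
    have := smooth_dot (t *: h + x) x L0 sf; rewrite addrK; clearbody h.
    rewrite !(dotZl, dotZr) dotBl => H; rewrite -(ler_pM2l t0); lra.
  - apply: continuous_subspaceT => t; apply: differentiable_continuous.
    by apply/derivable1_diffP; exact: ex_derive.
rewrite /phi scale1r scale0r add0r subrK expr0n expr1n/=; lra.
Qed.

(** The auxiliary point is one gradient step of length 1/L from y for the
    function z |-> f z - <gradient f x, z>, which is minimal at x. *)
Lemma smooth_convex_lower_bound L f x y : 0 < L -> smooth L f ->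
  strongly_convex 0 f -> (forall z, differentiable f z) ->
  let D := gradient f y - gradient f x in
  f x + dot (gradient f x) (y - x) + (2 * L)^-1 * dot D D <= f y.
Proof.
move=> L0 sf cf df /=; set D := gradient f y - _; pose z := y - L^-1 *: D.
have := strongly_convex_gradient z (df x) cf.
have := smooth_upper_bound y z L0 sf df.
rewrite (_ : z - x = (y - x) - L^-1 *: D); last by rewrite /z addrAC.
rewrite (_ : z - y = - (L^-1 *: D)); last by rewrite /z addrAC subrr add0r.
rewrite !(dotNl, dotNr, dotBr _ (y - x), dotZl, dotZr).
have : dot (gradient f y) D = dot D D + dot (gradient f x) D.
  by rewrite /D dotBl subrK.
move=> ->; rewrite invfM; move: (dot D D) (dot (gradient f x) D) => a b H1 H2.
have E : L / 2 * - (L^-1 * - (L^-1 * a)) = L^-1 / 2 * a.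
  by field; rewrite gt_eqF.
lra.
Qed.

(** The lower bound is not symmetric in x and y: adding its two instances
    cancels the values of f. *)
Lemma cocoercive L f x y : 0 < L -> smooth L f ->
  strongly_convex 0 f -> (forall z, differentiable f z) ->
  let D := gradient f x - gradient f y in L^-1 * dot D D <= dot D (x - y).
Proof.
move=> L0 sf cf df /=.
have := smooth_convex_lower_bound x y L0 sf cf df.
have := smooth_convex_lower_bound y x L0 sf cf df.
rewrite /= -[gradient f y - _]opprB -[y - x]opprB !(dotNl, dotNr) !opprK.
rewrite invfM (dotBl _ _ (x - y)); lra.
Qed.

Lemma strongly_monotone mu f x y : strongly_convex mu f ->
  (forall z, differentiable f z) ->
  mu * dot (x - y) (x - y) <= dot (gradient f x - gradient f y) (x - y).
Proof.
move=> cf df.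
have := strongly_convex_gradient x (df y) cf.
have := strongly_convex_gradient y (df x) cf.
rewrite -[y - x]opprB !(dotNl, dotNr) opprK (dotBl (gradient f x)); lra.
Qed.

End first_order.

(** * One step of the recursion *)

Section sarah_step.
Context (R : realType) (d n : nat) (f : 'I_n -> 'rV[R]_d -> R).
Context (p : 'I_n -> R) (eta : R).
Implicit Types (s : 'rV[R]_d * 'rV[R]_d) (g : 'rV[R]_d * 'rV[R]_d -> R).

Definition sarah_step (k : 'I_n) s : 'rV[R]_d * 'rV[R]_d :=
  let x' := s.1 - eta *: s.2 in
  (x', (n%:R * p k)^-1 *: (gradient (f k) x' - gradient (f k) s.1) + s.2).

Definition sarah_init (x : 'rV[R]_d) : 'rV[R]_d * 'rV[R]_d :=
  (x, n%:R^-1 *: \sum_(k < n) gradient (f k) x).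

(** The transition operator of the Markov chain of pairs (x^t, v^t). *)
Definition transition g s : R := \sum_k p k * g (sarah_step k s).

Lemma sarahS (x : 'rV[R]_d) (i : nat -> 'I_n) t :
  sarah f p eta x i t.+1 = sarah_step (i t.+1) (sarah f p eta x i t).
Proof. by rewrite /=; case: (sarah f p eta x i t). Qed.

Lemma transition_le g g' : (forall k, 0 <= p k) -> (forall s, g s <= g' s) ->
  forall s, transition g s <= transition g' s.
Proof. by move=> p0 gg s; apply: ler_sum => k _; rewrite ler_wpM2l. Qed.

Lemma transitionZ (a : R) g s :
  transition (fun s => a * g s) s = a * transition g s.
Proof. by rewrite mulr_sumr; apply: eq_bigr => k _; rewrite mulrCA. Qed.

Lemma iter_transition_ge0 g : (forall k, 0 <= p k) -> (forall s, 0 <= g s) ->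
  forall t s, 0 <= iter t transition g s.
Proof.
move=> p0 g0; elim=> [|t IH] s /=; first exact: g0.
apply: sumr_ge0 => k _.
by rewrite mulr_ge0.
Qed.

(** A one-step bound that holds at every state, reachable or not, propagates
    along the chain because the transition operator is linear and monotone. *)
Lemma iter_transition_le g (a : R) : (forall k, 0 <= p k) ->
  (forall s, transition g s <= a * g s) ->
  forall t s, iter t.+1 transition g s <= a * iter t transition g s.
Proof.
move=> p0 ga; elim=> [|t IH] s /=; first exact: ga.
by rewrite -transitionZ; apply: transition_le.
Qed.

End sarah_step.

Section contraction.
Context (R : realType) (d n : nat) (hn : (0 < n)%N).
Context (f : 'I_n -> 'rV[R]_d -> R) (L : 'I_n -> R) (mu eta : R).
Hypothesis f_diff : forall k x, differentiable (f k) x.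
Hypothesis L_gt0 : forall k, 0 < L k.
Hypothesis f_smooth : forall k, smooth (L k) (f k).
Hypothesis f_convex : forall k, strongly_convex 0 (f k).
Hypothesis mu_gt0 : 0 < mu.
Hypothesis f_strong : strongly_convex mu (fun x => mean (fun k => f k x)).
Hypothesis eta_gt0 : 0 < eta.
Hypothesis eta_lt : eta < 2 / mean L.
Context (p : 'I_n -> R).
Hypothesis p_def : forall k, p k = L k / \sum_(j < n) L j.

Lemma mean_gt0 : 0 < mean L.
Proof.
rewrite mulr_gt0 ?invr_gt0 ?ltr0n//.
rewrite (bigD1 (Ordinal hn))//= ltr_pwDl// sumr_ge0// => k _; exact: ltW.
Qed.

Let S_gt0 : 0 < \sum_(j < n) L j.
Proof.
by have := mean_gt0; rewrite pmulr_rgt0// invr_gt0 ltr0n.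
Qed.

Lemma prob_ge0 k : 0 <= p k.
Proof. by rewrite p_def divr_ge0// ltW. Qed.

Lemma prob_sum1 : \sum_k p k = 1.
Proof.
under eq_bigr do rewrite p_def.
by rewrite -mulr_suml divff// gt_eqF.
Qed.

(** Cocoercivity controls the second moment of the importance-weighted
    increment by its inner product with v, with the same constant for all the
    indices: this is what the sampling probabilities are chosen for. *)
Lemma transition_sqr_le (s : 'rV[R]_d * 'rV[R]_d) :
  let D k := gradient (f k) (s.1 - eta *: s.2) - gradient (f k) s.1 in
  transition f p eta (fun s => enorm s.2 ^+ 2) s <=
  enorm s.2 ^+ 2 + (2 - eta * mean L) * mean (fun k => dot (D k) s.2).
Proof.
case: s => x v /=; set x' := x - eta *: v.
pose D k := gradient (f k) x' - gradient (f k) x.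
have n0 : n%:R != 0 :> R by rewrite pnatr_eq0 -lt0n.
have term k : p k * enorm ((n%:R * p k)^-1 *: D k + v) ^+ 2 <=
    p k * dot v v + (2 - eta * mean L) * (n%:R^-1 * dot (D k) v).
  have Lk0 := L_gt0 k.
  have coco : (L k)^-1 * dot (D k) (D k) <= - eta * dot (D k) v.
    have := cocoercive x' x Lk0 (f_smooth k) (f_convex k) (f_diff k).
    rewrite /= -/(D k) (_ : x' - x = - eta *: v) ?dotZr//.
    by rewrite /x' addrAC subrr add0r scaleNr.
  have -> : (n%:R * p k)^-1 = mean L / L k.
    by rewrite p_def /mean; field; rewrite n0 !gt_eqF.
  have -> : p k = n%:R^-1 * L k / mean L.
    by rewrite p_def /mean; field; rewrite n0 gt_eqF.
  have lam0 := mean_gt0.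
  move: (D k) coco => Dk coco.
  rewrite enorm_sqr !(dotDl, dotDr, dotZl, dotZr) (dotC v Dk).
  set a := dot Dk Dk in coco *; set b := dot Dk v in coco *.
  set c := dot v v; set lam := mean L in lam0 *.
  have -> : n%:R^-1 * L k / lam * (lam / L k * (lam / L k * a) + lam / L k * b
      + (lam / L k * b + c)) =
    n%:R^-1 * L k / lam * c + n%:R^-1 * (2 * b + lam * ((L k)^-1 * a)).
    by field; rewrite n0 !gt_eqF.
  rewrite lerD2l (mulrCA (2 - _)) ler_pM2l ?invr_gt0 ?ltr0n//.
  have := ler_wpM2l (ltW lam0) coco; lra.
rewrite /transition (le_trans (ler_sum _ (fun k _ => term k)))//.
rewrite big_split/= -mulr_suml prob_sum1 mul1r -enorm_sqr lerD2l.
by rewrite /mean -!mulr_sumr.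
Qed.

Definition rate : R := 1 - (2 / (eta * mean L) - 1) * mu ^+ 2 * eta ^+ 2.

(** Strong convexity and smoothness bound the same quantity from both sides,
    whence mu <= mean L as soon as v <> 0. The argument gives the factor
    mu * mean L in the rate, which is then weakened to mu^2. *)
Lemma transition_contraction (s : 'rV[R]_d * 'rV[R]_d) :
  transition f p eta (fun s => enorm s.2 ^+ 2) s <= rate * enorm s.2 ^+ 2.
Proof.
apply: le_trans (transition_sqr_le s) _.
case: s => x v /=; set x' := x - eta *: v; set G := mean (fun k => dot _ v).
have lam0 := mean_gt0; have eta0 := eta_gt0; have mu0 := mu_gt0.
have hE : x' - x = - eta *: v by rewrite /x' addrAC subrr add0r scaleNr.
have GE : G = dot (gradient (fun z => mean (fun k => f k z)) x' -
                   gradient (fun z => mean (fun k => f k z)) x) v.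
  rewrite !gradient_mean// -scalerBr -sumrB dotZl dotC dot_sumr.
  by congr (_ * _); apply: eq_bigr => k _; rewrite dotC.
have G_le : mu * eta * enorm v ^+ 2 <= - G.
  have := strongly_monotone x' x f_strong
    (fun z => differentiable_mean (f_diff ^~ z)).
  rewrite hE !(dotZl _ v, dotZr) -GE -enorm_sqr => H.
  rewrite -(ler_pM2l eta0); lra.
have G_ge : - G <= mean L * eta * enorm v ^+ 2.
  rewrite /G /mean -mulrN -!mulrA ler_pM2l ?invr_gt0 ?ltr0n// -sumrN mulr_suml.
  apply: ler_sum => k _; rewrite -(ler_pM2l eta0).
  have := smooth_dot x' x (L_gt0 k) (f_smooth k).
  rewrite hE !(dotZl _ v, dotZr) -enorm_sqr; lra.
have lam_eta : eta * mean L < 2 by rewrite -ltr_pdivlMr.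
rewrite /rate; set lam := mean L in lam0 G_ge lam_eta *.
set N := enorm v ^+ 2 in G_le G_ge *; have N0 : 0 <= N by exact: sqr_ge0.
rewrite (mulrBl N 1) mul1r lerD2l.
have -> : - ((2 / (eta * lam) - 1) * mu ^+ 2 * eta ^+ 2 * N) =
   (2 - eta * lam) * - (mu ^+ 2 * eta / lam * N).
  by field; rewrite !gt_eqF.
rewrite ler_pM2l ?subr_gt0// lerNr; apply: (le_trans _ G_le).
have [N00|N_neq0] := eqVneq N 0; first by rewrite N00 !mulr0.
have Ngt0 : 0 < N by rewrite lt0r N_neq0.
have mu_lam : mu <= lam.
  have : mu * eta * N <= lam * eta * N by exact: le_trans G_le G_ge.
  by rewrite !ler_pM2r.
rewrite ler_wpM2r// ler_pdivrMr// (mulrAC mu eta) ler_wpM2r ?(ltW eta0)//.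
by rewrite expr2 ler_wpM2l// ltW.
Qed.

End contraction.

(** * Borel measurability and independence *)

Section borel.
Context d0 (T : measurableType d0) (R : realType) (d : nat).
Context (X : T -> 'rV[R]_d).
Hypothesis mX : forall j, measurable_fun setT (fun w => X w ord0 j).

(** An open set is the union of the boxes with rational centre and radius that
    it contains, and there are countably many of them. *)
Lemma measurable_preimage_open (U : set 'rV[R]_d) :
  open U -> measurable (X @^-1` U).
Proof.
move=> oU.
pose box (c : 'rV[rat]_d * rat) : set 'rV[R]_d :=
  [set y | forall j, `|y ord0 j - ratr (c.1 ord0 j)| < ratr c.2].
have -> : U = \bigcup_c (if `[< box c `<=` U >] then box c else set0).
  apply/seteqP; split => [x Ux|x [c _]]; last first.
    by case: asboolP => // cU /cU.
  have /nbhs_ballP[e /= e0 eU] := open_nbhs_nbhs (conj oU Ux).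
  have [r] := @rat_in_itvoo R 0 (e / 2) (divr_gt0 e0 (ltr0n _ 2)).
  rewrite in_itv/= => /andP[r0 re].
  have qex j : exists q : rat, `|x ord0 j - ratr q| < ratr r.
    have [|q] := @rat_in_itvoo R (x ord0 j - ratr r) (x ord0 j + ratr r).
      by rewrite ltrD2l gtrN.
    by rewrite in_itv/= => xq; exists q; rewrite distrC ltr_distl.
  have [q qE] := choice qex.
  exists (\row_j q j, r) => //; case: asboolP => [_|[]].
    by move=> j /=; rewrite mxE.
  move=> y /= yq; apply: eU; split=> // i j; rewrite (ord1 i) /ball/=.
  have := qE j; have := yq j; rewrite mxE distrC => h1 h2.
  rewrite (le_lt_trans (ler_distD (ratr (q j)) _ _))//; lra.
rewrite preimage_bigcup; apply: countable_bigcupT_measurable => // c.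
case: asboolP => _; last by rewrite preimage_set0.
rewrite (_ : X @^-1` box c = \big[setI/setT]_(j < d) 
  (fun w => `|X w ord0 j - ratr (c.1 ord0 j)|) @^-1` `]-oo, ratr c.2[%classic).
  apply: bigsetI_measurable => j _.
  rewrite -[X in measurable X]setTI.
  have : measurable_fun setT (fun w => `|X w ord0 j - ratr (c.1 ord0 j)|).
    apply: measurableT_comp => //; exact: measurable_funB.
  by apply.
rewrite -bigcap_seq; apply/seteqP; split => [w Xw j _|w Xw j].
  by rewrite /= in_itv/=; exact: Xw.
by have := Xw j; rewrite /= mem_index_enum in_itv/=; exact.
Qed.

Lemma measurable_continuous_comp (g : 'rV[R]_d -> R) :
  continuous g -> measurable_fun setT (g \o X).
Proof.
move=> /continuousP cg; apply: (measurability _ (RGenOpens.measurableE R)).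
move=> _ [_ [a [b ->]]] <-; rewrite setTI.
exact: (measurable_preimage_open (cg _ (interval_open _ _))).
Qed.

End borel.

Section integral_independent.
Local Open Scope ereal_scope.
Context d0 (T : measurableType d0) (R : realType) (P : probability T R).

Lemma ge0_integral_mrestr (A : set T) (mA : measurable A) (g : T -> \bar R) :
  measurable_fun setT g -> (forall w, 0 <= g w) ->
  \int[mrestr P mA]_w g w = \int[P]_(w in A) g w.
Proof.
move=> mg g0; rewrite -(setUv A) ge0_integral_setU//; last 3 first.
- exact: measurableC.
- by rewrite setUv.
- by rewrite disj_set2E setICr.
rewrite (@eq_measure_integral _ _ _ A P); last first.
  by move=> B mB BA; rewrite /= /mrestr setIidl.
rewrite (@eq_measure_integral _ _ _ (~` A) mzero); last first.
  move=> B mB BA; rewrite /= /mrestr (_ : B `&` A = set0) ?measure0//.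
  exact/disjoints_subset.
by rewrite integral_measure_zero adde0.
Qed.

(** Restricting P to A and scaling P by P A have the same image measure
    under g. *)
Lemma ge0_integral_independent (A : set T) (g : T -> R) :
  measurable A -> measurable_fun setT g -> (forall w, (0 <= g w)%R) ->
  (forall B, measurable B -> P (g @^-1` B `&` A) = P A * P (g @^-1` B)) ->
  \int[P]_(w in A) (g w)%:E = P A * \int[P]_w (g w)%:E.
Proof.
move=> mA mg g0 ind.
pose k : {nonneg R} := NngNum (fine_ge0 (measure_ge0 P A)).
have PA : P A = k%:num%:E by rewrite /= fineK// fin_num_measure.
rewrite -(ge0_integral_mrestr mA); last 2 first.
- exact/measurable_EFinP.
- by move=> w; rewrite lee_fin.
rewrite PA -ge0_integral_mscale//; last 2 first.
- exact/measurable_EFinP.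
- by move=> w; rewrite lee_fin.
pose h (y : R) := (Num.max y 0)%:E.
have hg : (fun w => (g w)%:E) = h \o g.
  by apply/funext => w; rewrite /h/= max_l.
have mh : measurable_fun setT h by apply/measurable_EFinP/measurable_maxr.
have h0 : {in [set: R], forall y, 0 <= h y}.
  by move=> y _; rewrite lee_fin le_max lexx orbT.
rewrite hg -!(ge0_integral_pushforward mg _ measurableT mh h0).
apply: eq_measure_integral => B mB _.
by rewrite /= /pushforward/= /mscale/= /mrestr ind// PA.
Qed.

End integral_independent.

(** * Continuity of one step *)

Lemma cvg_sum (R : numFieldType) (V : normedModType R) (T : Type)
    (F : set_system T) {FF : Filter F} n (u : 'I_n -> T -> V) (l : 'I_n -> V) :
  (forall k, u k @ F --> l k) ->
  \sum_k u k w @[w --> F] --> \sum_k l k.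
Proof. by move=> ul; apply: cvg_big => //; exact: add_continuous. Qed.

Section continuity.
Context (R : realType) (d n : nat) (f : 'I_n -> 'rV[R]_d -> R).
Context (p : 'I_n -> R) (eta : R).
Implicit Types (g : 'rV[R]_d * 'rV[R]_d -> R).

Lemma continuous_rV (T : topologicalType) (F : T -> 'rV[R]_d) :
  (forall j, continuous (fun w => F w ord0 j)) -> continuous F.
Proof.
move=> cF w A [Q nQ QA].
have : \forall w' \near w, forall j, Q ord0 j (F w' ord0 j).
  by apply: filter_forall => j; apply: cF; exact: nQ.
by apply: filterS => w' Qw'; apply: QA => i j; rewrite (ord1 i).
Qed.

Lemma continuous_enorm_sqr : continuous (fun v : 'rV[R]_d => enorm v ^+ 2).
Proof.
under eq_fun do rewrite enorm_sqr.
move=> v; apply: (@cvg_sum _ R^o _ (nbhs v)) => j.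
by apply: cvgM; exact: coord_continuous.
Qed.

Lemma cvg_enorm_sub (x : 'rV[R]_d) : (fun y => enorm (x - y)) @ x --> (0 : R).
Proof.
have cB : (fun y => x - y) @ x --> x - x.
  apply: (@cvgB R 'rV[R]_d _ (nbhs x) _ (cst x) id x x).
    exact: cvg_cst.
  exact: cvg_id.
have cE := cvg_comp _ _ cB (@continuous_enorm_sqr (x - x)).
rewrite -sqrtr0 (_ : 0 = enorm (x - x) ^+ 2); last first.
  by rewrite enorm_sqr subrr /dot big1// => k _; rewrite mxE mul0r.
under eq_fun do rewrite -[enorm _]ger0_norm ?enorm_ge0// -sqrtr_sqr.
exact: (cvg_comp _ _ cE (@sqrt_continuous R _)).
Qed.

(** The topology of row vectors comes from the sup norm, while smoothness is
    about the Euclidean norm; coordinates compare the two. *)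
Lemma smooth_continuous (L : R) (u : 'rV[R]_d -> R) :
  smooth L u -> continuous (gradient u).
Proof.
move=> su; apply: continuous_rV => j x.
have coord_le (v : 'rV[R]_d) : `|v ord0 j| <= enorm v.
  rewrite -sqrtr_sqr ler_wsqrtr// (bigD1 j)//= lerDl.
  by apply: sumr_ge0 => k _; exact: sqr_ge0.
have cL : (fun y => L * enorm (x - y)) @ nbhs x --> L * 0.
  by apply: cvgMl_tmp; exact: cvg_enorm_sub.
rewrite mulr0 in cL.
suff : (fun y => gradient u y ord0 j) @ nbhs x --> gradient u x ord0 j by [].
apply/(@cvgrPdist_lt _ R^o) => e e0; apply: filterS (cvgr_lt _ cL _ e0) => y.
apply: le_lt_trans; apply: le_trans (su x y).
by apply: le_trans (coord_le _); rewrite !mxE.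
Qed.

Hypothesis gradient_continuous : forall k, continuous (gradient (f k)).

Lemma continuous_sarah_step k : continuous (sarah_step f p eta k).
Proof.
move=> [x v].
have c1 : fst @ nbhs (x, v) --> x by exact: cvg_fst.
have c2 : snd @ nbhs (x, v) --> v by exact: cvg_snd.
have cx : (fun s : 'rV[R]_d * 'rV[R]_d => s.1 - eta *: s.2) @ nbhs (x, v)
    --> x - eta *: v.
  apply: (@cvgB R 'rV[R]_d _ (nbhs (x, v))); first exact: c1.
  exact: (@cvgZl_tmp R 'rV[R]_d _ (nbhs (x, v)) _ eta _ _ c2).
have cv : (fun s => (sarah_step f p eta k s).2) @ nbhs (x, v)
    --> (sarah_step f p eta k (x, v)).2.
  apply: (@cvgD R 'rV[R]_d _ (nbhs (x, v))); last exact: c2.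
  apply: (@cvgZl_tmp R 'rV[R]_d _ (nbhs (x, v))).
  apply: (@cvgB R 'rV[R]_d _ (nbhs (x, v))).
    exact: (cvg_comp _ _ cx (@gradient_continuous k _)).
  exact: (cvg_comp _ _ c1 (@gradient_continuous k _)).
exact: (cvg_pair cx cv).
Qed.

Lemma continuous_sarah_init : continuous (sarah_init f).
Proof.
move=> x.
have cv : (fun x => (sarah_init f x).2) @ nbhs x --> (sarah_init f x).2.
  apply: (@cvgZl_tmp R 'rV[R]_d _ (nbhs x)).
  apply: (@cvg_sum R 'rV[R]_d _ (nbhs x)) => k.
  exact: gradient_continuous.
have cx : id @ nbhs x --> x by exact: cvg_id.
exact: (cvg_pair cx cv).
Qed.

Lemma continuous_comp_init g :
  continuous g -> continuous (g \o sarah_init f).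
Proof.
by move=> cg x; apply: (cvg_comp _ _ (@continuous_sarah_init x)); exact: cg.
Qed.

Lemma continuous_comp_step g k :
  continuous g -> continuous (g \o sarah_step f p eta k).
Proof.
by move=> cg s; apply: (cvg_comp _ _ (@continuous_sarah_step k s)); exact: cg.
Qed.

Lemma continuous_iter_transition g t :
  continuous g -> continuous (iter t (transition f p eta) g).
Proof.
elim: t => [//|t IH] cg /= s.
apply: (@cvg_sum _ R^o _ (nbhs s)) => k; apply: cvgMl_tmp.
exact: (cvg_comp _ _ (@continuous_sarah_step k s) (IH cg _)).
Qed.

Lemma iter_transition_sum (g : 'I_n -> 'rV[R]_d * 'rV[R]_d -> R) t s :
  iter t (transition f p eta) (fun s => \sum_k p k * g k s) s =
  \sum_k p k * iter t (transition f p eta) (g k) s.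
Proof.
elim: t s => [//|t IH] s /=; transitivity (\sum_l \sum_k p l * (p k *
    iter t (transition f p eta) (g k) (sarah_step f p eta l s))).
  by apply: eq_bigr => l _; rewrite -mulr_sumr -IH.
rewrite exchange_big; apply: eq_bigr => k _ /=.
by rewrite mulr_sumr; apply: eq_bigr => l _; rewrite mulrCA.
Qed.

End continuity.

(** * Independence of the draws and the starting point *)

(** Applies [measurable_continuous_comp] to T equipped with the smaller
    sigma-algebra generated by X. *)
Lemma sigma_vector_preimage d0 (T : measurableType d0) (R : realType) (d : nat)
    (X : T -> 'rV[R]_d) (g : 'rV[R]_d -> R) (B : set R) :
  continuous g -> measurable B -> sigma_vector X ((g \o X) @^-1` B).
Proof.
move=> cg mB.
pose T' := g_sigma_algebraType (sigma_vector X).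
have mX j : measurable_fun setT (fun w : T' => X w ord0 j).
  move=> _ C mC; apply: sub_sigma_algebra; apply: sub_sigma_algebra.
  rewrite -bigcup_seq; exists j; first by rewrite /= mem_index_enum.
  by exists C.
have := measurable_continuous_comp mX cg measurableT mB.
rewrite setTI /measurable/= [X in X _ -> _]sigma_algebra_id//.
exact: smallest_sigma_algebra.
Qed.

Section decoupling.
Context (R : realType) (d n : nat) (f : 'I_n -> 'rV[R]_d -> R).
Context (p : 'I_n -> R) (eta : R).
Hypothesis gradient_continuous : forall k, continuous (gradient (f k)).
Hypothesis p_ge0 : forall k, 0 <= p k.
Context (disp : measure_display) (T : measurableType disp).
Context (P : probability T R) (X0 : T -> 'rV[R]_d) (i : nat -> T -> 'I_n).
Hypothesis X0_meas : forall j, measurable_fun setT (fun w => X0 w ord0 j).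
Hypothesis i_meas :
  forall t, (1 <= t)%N -> forall k, measurable (i t @^-1` [set k]).
Hypothesis i_law : forall t, (1 <= t)%N -> forall k,
  P (i t @^-1` [set k]) = (p k)%:E.
Hypothesis indep : mutually_independent P (sarah_sigmas X0 i).

Let state w t := sarah f p eta (X0 w) (fun s => i s w) t.
Let chain t g := iter t (transition f p eta) g.

Definition drawn (J : {fset nat}) (h : nat -> 'I_n) : set T :=
  \bigcap_(s in [set` J]) (i s @^-1` [set h s]).

Lemma measurable_drawn (J : {fset nat}) h : (forall s, s \in J -> 0 < s)%N ->
  measurable (drawn J h).
Proof.
by move=> J0; apply: bigcap_measurableType => s sJ; exact/i_meas/J0.
Qed.

Lemma prob_drawn (J : {fset nat}) h (B : set T) :
  (forall s, s \in J -> 0 < s)%N -> sigma_vector X0 B ->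
  (P (B `&` drawn J h) = P B * (\prod_(s <- J) p (h s))%:E)%E.
Proof.
move=> J0 XB.
have n0J : 0%N \notin J by apply/negP => /J0.
pose A s := if s is 0%N then B else i s @^-1` [set h s].
have AF s : s \in (0%N |` J)%fset -> sarah_sigmas X0 i s (A s).
  by case: s => [//|s] _; exists [set h s.+1] => //; rewrite setTI.
have := indep AF; rewrite bigcap_fsetU1 big_fsetU1//= => EP.
have A_pos s : s \in J -> A s = i s @^-1` [set h s].
  by case: s => // /J0.
have -> : drawn J h = \bigcap_(s in [set` J]) A s.
  by apply: eq_bigcapr => s sJ; rewrite A_pos.
rewrite EP -prodEFin; congr (_ * _)%E.
by apply: eq_big_seq => s sJ; rewrite A_pos// i_law// J0.
Qed.

Lemma measurable_state (g : 'rV[R]_d * 'rV[R]_d -> R) t : continuous g ->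
  measurable_fun setT (fun w => g (state w t)).
Proof.
elim: t g => [|t IH] g cg.
  apply: (measurable_continuous_comp X0_meas (g := g \o sarah_init f)).
  exact: continuous_comp_init.
move=> _ B mB; rewrite setTI.
rewrite (_ : _ @^-1` B = \big[setU/set0]_k (i t.+1 @^-1` [set k] `&`
   (fun w => g (sarah_step f p eta k (state w t))) @^-1` B)).
  apply: bigsetU_measurable => k _; apply: measurableI; first exact: i_meas.
  rewrite -[X in measurable X]setTI.
  apply: (IH (g \o sarah_step f p eta k)) => //.
  exact: continuous_comp_step.
rewrite -bigcup_seq; apply/seteqP; split => [w|w [k _ []]] /=.
  rewrite /state sarahS => Bw; exists (i t.+1 w) => //=.
  by rewrite mem_index_enum.
by rewrite /state sarahS => <-.
Qed.

Lemma measurable_chain (g : 'rV[R]_d * 'rV[R]_d -> R) t : continuous g ->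
  measurable_fun setT (fun w => chain t g (sarah_init f (X0 w))).
Proof.
move=> cg.
apply: (measurable_continuous_comp X0_meas (g := chain t g \o sarah_init f)).
by apply: continuous_comp_init => //; exact: continuous_iter_transition.
Qed.

(** The induction goes backwards along the trajectory: conditioning on the value
    of the last draw i_{t+1} turns g into its composition with a fixed step and
    moves the draw into J. The statement therefore carries an arbitrary set J of
    draws later than t, with prescribed values h; at t = 0 only the independence
    of these draws and X0 is left. *)
Lemma decoupling t (g : 'rV[R]_d * 'rV[R]_d -> R) (J : {fset nat}) h :
  continuous g -> (forall s, 0 <= g s) -> (forall s, s \in J -> t < s)%N ->
  (\int[P]_(w in drawn J h) (g (state w t))%:E =
   (\prod_(s <- J) p (h s))%:E *
   \int[P]_w (chain t g (sarah_init f (X0 w)))%:E)%E.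
Proof.
have J_gt0 (K : {fset nat}) u : (forall s, s \in K -> u < s)%N ->
    (forall s, s \in K -> 0 < s)%N.
  by move=> Ku s /Ku; exact: leq_trans.
elim: t g J h => [|t IH] g J h cg g0 Jt.
  have cg0 : continuous (g \o sarah_init f) by exact: continuous_comp_init.
  have P_drawn : P (drawn J h) = (\prod_(s <- J) p (h s))%:E.
    rewrite -[drawn J h]setTI prob_drawn// ?probability_setT ?mul1e//.
    have := sigma_vector_preimage (X := X0) cg0 measurableT.
    by rewrite preimage_setT.
  rewrite ge0_integral_independent ?P_drawn//.
  - exact: measurable_drawn.
  - exact: (measurable_state 0 cg).
  - move=> B mB; have XB := sigma_vector_preimage (X := X0) cg0 mB.
    rewrite (prob_drawn h (J_gt0 _ _ Jt) XB).
    exact: muleC.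
have tJ : t.+1 \notin J by apply/negP => /Jt; rewrite ltnn.
pose h' k s := if s == t.+1 then k else h s.
have drawnE k :
    drawn (t.+1 |` J)%fset (h' k) = i t.+1 @^-1` [set k] `&` drawn J h.
  rewrite /drawn bigcap_fsetU1 /h' eqxx; congr (_ `&` _).
  apply: eq_bigcapr => s sJ /=.
  by case: eqP => // st; move: tJ; rewrite -st sJ.
have prodE k : \prod_(s <- (t.+1 |` J)%fset) p (h' k s) =
    p k * \prod_(s <- J) p (h s).
  rewrite big_fsetU1//= /h' eqxx; congr (_ * _).
  apply: eq_big_seq => s sJ; case: eqP => // st.
  by move: tJ; rewrite -st sJ.
have J'0 s : s \in (t.+1 |` J)%fset -> (t < s)%N.
  by rewrite !inE => /predU1P[->//|/Jt]; exact: ltnW.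
have cgk k : continuous (g \o sarah_step f p eta k).
  exact: continuous_comp_step.
transitivity (\sum_k \int[P]_(w in drawn (t.+1 |` J)%fset (h' k))
    ((g \o sarah_step f p eta k) (state w t))%:E)%E.
  have DE : drawn J h = \big[setU/set0]_k drawn (t.+1 |` J)%fset (h' k).
    rewrite -bigcup_seq; apply/seteqP; split => w.
      move=> Jw; exists (i t.+1 w); first by rewrite /= mem_index_enum.
      by rewrite drawnE.
    by move=> [k _]; rewrite drawnE => -[].
  rewrite {1}DE ge0_integral_bigsetU//; last 5 first.
  - by move=> k; apply: measurable_drawn; exact: J_gt0 J'0.
  - exact: index_enum_uniq.
  - apply/trivIsetP => k l _ _ kl; rewrite -subset0 => w [].
    rewrite !drawnE => -[/= wk _] [/= wl _]; move: kl.
    by rewrite -wk -wl eqxx.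
  - apply/measurable_EFinP.
    by apply: measurable_funS (measurable_state t.+1 cg).
  - by move=> w _; rewrite lee_fin.
  apply: eq_bigr => k _; apply: eq_integral => w.
  by rewrite inE drawnE /state sarahS => -[/= -> _].
have IHk k := IH _ _ (h' k) (cgk k) (fun s => g0 _) J'0.
rewrite (eq_bigr _ (fun k _ => IHk k)).
under eq_bigr do rewrite prodE mulrC EFinM -muleA.
have chain_ge0 k w :
    (0 <= (chain t (g \o sarah_step f p eta k) (sarah_init f (X0 w)))%:E)%E.
  by rewrite lee_fin; apply: iter_transition_ge0 => // s; exact: g0.
rewrite -ge0_sume_distrr; last first.
  by move=> k _; rewrite mule_ge0 ?lee_fin// integral_ge0.
congr (_ * _)%E.
have mchain k : measurable_fun setT (fun w =>
    (chain t (g \o sarah_step f p eta k) (sarah_init f (X0 w)))%:E).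
  exact/measurable_EFinP/measurable_chain.
have scale k := ge0_integralZl_EFin P measurableT
  (fun w _ => chain_ge0 k w) (mchain k) (p_ge0 k).
rewrite -(eq_bigr _ (fun k _ => scale k)).
rewrite -ge0_integral_sum//; last 2 first.
- by move=> k; exact: measurable_funeM.
- by move=> k w _; rewrite mule_ge0// lee_fin.
apply: eq_integral => w _.
rewrite sumEFin /chain iterSr; congr EFin.
by rewrite -iter_transition_sum.
Qed.

Lemma expectation_state (g : 'rV[R]_d * 'rV[R]_d -> R) t :
  continuous g -> (forall s, 0 <= g s) ->
  ('E_P[fun w => g (state w t)] =
   \int[P]_w (chain t g (sarah_init f (X0 w)))%:E)%E.
Proof.
move=> cg g0; rewrite unlock.
have drawn0 : drawn fset0 (fun=> i 0%N point) = setT.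
  by rewrite /drawn set_fset0 bigcap_set0.
by rewrite -{1}drawn0 decoupling// big_seq_fset0 mul1e.
Qed.

(** A negative rate is only compatible with the one-step bound when every
    term vanishes. *)
Lemma integral_chain_le (g : 'rV[R]_d * 'rV[R]_d -> R) (a : R) t :
  continuous g -> (forall s, 0 <= g s) ->
  (forall s, transition f p eta g s <= a * g s) ->
  let c u := (\int[P]_w (chain u g (sarah_init f (X0 w)))%:E)%E in
  (c t.+1 <= a%:E * c t)%E /\ (a%:E * c t <= (a ^+ t.+1)%:E * c 0%N)%E.
Proof.
move=> cg g0 ga c.
have chain_ge0 u s : 0 <= chain u g s by exact: iter_transition_ge0.
have chain_le u s : chain u.+1 g s <= a * chain u g s.
  exact: iter_transition_le.
have [a0|a0] := ltP a 0.
  have c0 u : c u = 0%E.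
    apply: integral0_eq => w _; congr EFin; apply/eqP.
    rewrite eq_le chain_ge0 andbT -(nmulr_rge0 _ a0).
    exact: le_trans (chain_ge0 _ _) (chain_le _ _).
  by rewrite !c0 !mule0.
have cS u : (c u.+1 <= a%:E * c u)%E.
  rewrite -ge0_integralZl_EFin//; last 2 first.
  - by move=> w _; rewrite lee_fin.
  - exact/measurable_EFinP/measurable_chain.
  apply: ge0_le_integral => //.
  - by move=> w _; rewrite lee_fin.
  - exact/measurable_EFinP/measurable_chain.
  - apply: measurable_funeM; exact/measurable_EFinP/measurable_chain.
  - by move=> w _; rewrite -EFinM lee_fin.
split=> //.
elim: t => [|t IH]; first by rewrite expr1.
rewrite exprS EFinM -muleA lee_wpmul2l ?lee_fin//.
exact: le_trans (cS t) IH.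
Qed.

End decoupling.

Theorem theorem21 (R : realType) (d n : nat) (hn : (0 < n)%N)
    (f : 'I_n -> 'rV[R]_d -> R) (L : 'I_n -> R) (mu eta : R)
    (f_diff : forall k x, differentiable (f k) x)
    (L_gt0 : forall k, 0 < L k)
    (f_smooth : forall k, smooth (L k) (f k))
    (f_convex : forall k, convex_function [set: convex_lmodType 'rV[R]_d] (f k))
    (mu_gt0 : 0 < mu)
    (f_strong : strongly_convex mu (fun x => mean (fun k => f k x)))
    (eta_gt0 : 0 < eta) (eta_lt : eta < 2 / mean L)
    (p : 'I_n -> R) (p_def : forall k, p k = L k / \sum_(j < n) L j)
    (disp : measure_display) (T : measurableType disp) (P : probability T R)
    (X0 : T -> 'rV[R]_d) (i : nat -> T -> 'I_n)
    (X0_meas : forall j : 'I_d, measurable_fun setT (fun w => X0 w ord0 j))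
    (i_meas : forall t, (1 <= t)%N -> forall k, measurable (i t @^-1` [set k]))
    (i_law : forall t, (1 <= t)%N -> forall k,
       P (i t @^-1` [set k]) = (p k)%:E)
    (indep : mutually_independent P (sarah_sigmas X0 i)) :
  let v t w := (sarah f p eta (X0 w) (fun s => i s w) t).2 in
  let rho := 1 - (2 / (eta * mean L) - 1) * mu ^+ 2 * eta ^+ 2 in
  forall t : nat, (1 <= t)%N ->
    ('E_P[fun w => (enorm (v t w) ^+ 2)%R]
       <= rho%:E * 'E_P[fun w => (enorm (v t.-1 w) ^+ 2)%R])%E /\
    (rho%:E * 'E_P[fun w => (enorm (v t.-1 w) ^+ 2)%R]
       <= (rho ^+ t)%R%:E *
          'E_P[fun w =>
             (enorm (gradient (fun x => mean (fun k => f k x)) (X0 w)) ^+ 2)%R])%E.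
Proof.
move=> v rho [//|t] _.
have f_convex0 k : strongly_convex 0 (f k) by exact: strongly_convex0.
have gradient_cont k : continuous (gradient (f k)).
  exact: smooth_continuous (f_smooth k).
have p0 k : 0 <= p k by exact: (prob_ge0 hn L_gt0 p_def).
pose N (s : 'rV[R]_d * 'rV[R]_d) := enorm s.2 ^+ 2.
have cN : continuous N.
  move=> [x u]; have c2 : snd @ nbhs (x, u) --> u by exact: cvg_snd.
  exact: (cvg_comp _ _ c2 (@continuous_enorm_sqr _ _ u)).
have N0 s : 0 <= N s by exact: sqr_ge0.
have E u : ('E_P[fun w => (enorm (v u w) ^+ 2)%R] = \int[P]_w
    (iter u (transition f p eta) N (sarah_init f (X0 w)))%:E)%E.
  exact: (expectation_state _ gradient_cont p0 X0_meas i_meas i_law indep _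
            cN N0).
have -> : (fun w =>
    enorm (gradient (fun x => mean (fun k => f k x)) (X0 w)) ^+ 2) =
    (fun w => enorm (v 0%N w) ^+ 2).
  by apply/funext => w; rewrite gradient_mean.
have contraction s : transition f p eta N s <= rho * N s.
  exact: (transition_contraction hn).
rewrite !E.
exact: (integral_chain_le gradient_cont p0 P X0_meas t cN N0 contraction).
Qed.
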